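(* Let $p$ be a prime, $K$ a finite extension of $\mathbb{Q}_p$, and $A\subset K((\frac1T))$ a $K$-subalgebra with $A\cap K[[\frac1T]]=K$ and $g:=\dim_KK((\frac1T))/(A+K[[\frac1T]])<\infty$, which is strictly integral. Let $\boldsymbol{\mu}=(\mu_1,\ldots,\mu_g)$ be its gap sequence. Then the map $$\mathcal{M}_K^{\oplus g}\to\Gamma_A,\qquad\vec{\pi}=(\pi_i)_{i=1}^g\mapsto[h_{\boldsymbol{\mu}}(T;\vec{\pi})]$$ is injective.
   Context: $|\cdot|$ is the absolute value on $K$ with $|p|=1/p$, $O_K=\{|a|\le1\}$, $\mathcal{M}_K=\{|a|<1\}$. $K((\frac1T))$ is the field of series $\sum_{i\le n}v_iT^i$; the degree is the largest exponent with nonzero coefficient. Put $\underline{M}(A)=\{\deg v : 0\ne v\in A\}\subset\mathbb{Z}_{\ge0}$, written $\{s_1<s_2<\cdots\}$; the gap sequence is $\mathbb{Z}_{\ge0}\setminus\underline{M}(A)=\{\mu_1<\cdots<\mu_g\}$. The standard basis of $A$ is the unique basis $v_i=\sum_jv_{ij}T^j$ with $v_i$ monic of degree $s_i$ and $v_{i,s_j}=0$ for $i>j\ge1$; $A$ is strictly integral if all $v_{ij}\in O_K$. $H:=\{\sum_{i\in\mathbb{Z}}a_iT^i : a_i\in K,\ \sup|a_i|<\infty,\ \lim_{i\to+\infty}|a_i|=0\}$, a field complete for the norm $\|\sum a_iT^i\|=\sup|a_i|$. $A^{\mathrm{an}}$ is the closure of $A$ in $H$ (a $K$-subalgebra). For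 $0\le\rho<1$, $\Gamma_\rho:=\{h=\sum h_iT^i\in H^* : \|h\|=|h_0|=1,\ |h_i|\le\rho^i\ \forall i>0\}$ (so for $\rho=0$, $h_i=0$ for all $i>0$), $\Gamma:=\bigcup_{0\le\rho<1}\Gamma_\rho$, and $\Gamma_A:=\Gamma/\big(((A^{\mathrm{an}})^*\cap\Gamma)\Gamma_0\big)$; $[h]$ denotes the class of $h\in\Gamma$. With $l(T):=\sum_{k\ge0}p^{-k}T^{p^k}$, set $h(T;\pi):=\exp(l(\pi T))$ for $\pi\in\mathcal{M}_K$ and $h_{\boldsymbol{\mu}}(T;\vec{\pi}):=\prod_{i=1}^gh(T^{\mu_i};\pi_i)\in\Gamma$. *)

(* Defs.v *)
From HB Require Import structures.
From mathcomp Require Import all_boot all_order all_algebra all_field.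
From mathcomp Require Import all_classical all_reals all_analysis.

Set Implicit Arguments.
Unset Strict Implicit.
Unset Printing Implicit Defensive.

Import Order.TTheory GRing.Theory Num.Theory.
Import numFieldNormedType.Exports.

Local Open Scope classical_set_scope.
Local Open Scope ring_scope.

Section AbsoluteValues.
Context {R : realType}.

(* Non-archimedean absolute values with values in the reals. *)
Record absolute_value (F : fieldType) (abs : F -> R) : Prop := AbsoluteValue {
  absv_ge0 : forall x, 0 <= abs x;
  absv_eq0 : forall x, abs x = 0 <-> x = 0;
  absvM : forall x y, abs (x * y) = abs x * abs y;
  absv_ultra : forall x y, abs (x + y) <= Num.max (abs x) (abs y) }.

Definition abs_complete (F : fieldType) (abs : F -> R) : Prop :=
  forall u : nat -> F,
    (forall e : R, 0 < e -> exists N : nat, forall m n : nat,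
      (N <= m)%N -> (N <= n)%N -> abs (u m - u n) < e) ->
    exists l : F, (fun n => abs (u n - l)) @ \oo --> (0 : R).

Definition padic_abs (p : nat) (q : rat) : R :=
  if q == 0 then 0
  else p%:R ^+ logn p `|denq q|%N / p%:R ^+ logn p `|numq q|%N.

(* The field of p-adic numbers is not in the libraries; it is characterized
   here, up to a unique isometric isomorphism, as the completion of the
   rationals for the p-adic absolute value. *)
Record is_padic_field (p : nat) (Qp : fieldType) (abs : Qp -> R) : Prop :=
  IsPadicField {
    padic_absv : absolute_value abs;
    padic_abs_ratr : forall q : rat, abs (ratr q) = padic_abs p q;
    padic_dense : forall (x : Qp) (e : R), 0 < e ->
      exists q : rat, abs (x - ratr q) < e;
    padic_complete : abs_complete abs }.

(* As Qp is complete, the absolute value of a finite extension extending that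
   of Qp is unique; it is the one normalized by |p| = 1/p. *)
Definition extends_abs (Qp : fieldType) (absQ : Qp -> R)
    (K : fieldExtType Qp) (abs : K -> R) : Prop :=
  absolute_value abs /\ forall a : Qp, abs a%:A = absQ a.

End AbsoluteValues.

(* A two-sided series sum_(i in Z) a_i T^i is represented by its coefficient
   function int -> K, which carries the pointwise K-vector space structure. *)

Section Laurent.
Context {K : fieldType}.

Definition one_series : int -> K := fun n => (n == 0)%:R.

Definition laurent : set (int -> K) :=
  [set f | exists n : int, forall m : int, n < m -> f m = 0].

Definition laurent_nonpos : set (int -> K) :=
  [set f | forall m : int, 0 < m -> f m = 0].

(* For factors in K((1/T)) only finitely many terms of the sum are nonzero. *)
Definition laurent_mul (a b : int -> K) : int -> K :=
  fun n => \sum_(i \in [set: int]) a i * b (n - i).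

Definition has_degree (f : int -> K) (n : int) : Prop :=
  f n != 0 /\ forall m : int, n < m -> f m = 0.

Record is_subalgebra (A : set (int -> K)) : Prop := IsSubalgebra {
  subalg_laurent : A `<=` laurent;
  subalg_1 : A one_series;
  subalg_add : forall a b, A a -> A b -> A (a + b);
  subalg_scale : forall (c : K) a, A a -> A (c \*o a);
  subalg_mul : forall a b, A a -> A b -> A (laurent_mul a b) }.

(* dim_K V / W = g : the classes of some e_1, ..., e_g in V form a basis *)
Definition quotient_dim (V W : set (int -> K)) (g : nat) : Prop :=
  exists e : 'I_g -> (int -> K),
    [/\ forall i, V (e i),
        forall f, V f -> exists c : 'I_g -> K, W (f - \sum_(i < g) c i \*o e i)
      & forall c : 'I_g -> K, W (\sum_(i < g) c i \*o e i) ->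
          forall i, c i = 0].

Definition set_sum (V W : set (int -> K)) : set (int -> K) :=
  [set f | exists v w, [/\ V v, W w & f = v + w]].

(* Only degrees in nat are recorded: a nonzero element of A of negative
   degree is excluded by the condition that A meets K[[1/T]] in K. *)
Definition degrees (A : set (int -> K)) : set nat :=
  [set n | exists2 v, A v & has_degree v n%:Z].

Definition is_gap_sequence (A : set (int -> K)) (g : nat) (mu : 'I_g -> nat) :=
  (forall i j : 'I_g, (i < j)%N -> (mu i < mu j)%N) /\
  range mu = ~` degrees A.

Definition is_basis (A : set (int -> K)) (v : nat -> (int -> K)) : Prop :=
  [/\ forall i, A (v i),
      forall a, A a -> exists n (c : nat -> K), a = \sum_(i < n) c i \*o v i
    & forall n (c : nat -> K), \sum_(i < n) c i \*o v i = 0 ->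
        forall i, (i < n)%N -> c i = 0].

(* The indices are shifted by one: s 0 < s 1 < ... enumerates the degrees. *)
Definition is_standard_basis (A : set (int -> K)) (v : nat -> (int -> K)) :=
  exists s : nat -> nat,
    [/\ forall i j, (i < j)%N -> (s i < s j)%N,
        range s = degrees A,
        is_basis A v,
        forall i, has_degree (v i) (s i)%:Z /\ v i (s i)%:Z = 1
      & forall i j, (j < i)%N -> v i (s j)%:Z = 0].

End Laurent.

Section FormalExponential.
Context {K : fieldType}.

(* Coefficients of exp(f) for a power series f without constant term; then
   f^n/n! contributes to degree m only for n <= m, and f may be truncated
   after degree m. *)
Definition fps_exp (f : nat -> K) : nat -> K :=
  fun m => (\sum_(n < m.+1)
              (n`!%:R^-1 : K) *: (\poly_(i < m.+1) f i) ^+ n)`_m.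

(* Coefficients of l(T) = sum_k p^-k T^(p^k). *)
Definition l_coef (p i : nat) : K :=
  if i == (p ^ logn p i)%N then (p%:R ^+ logn p i)^-1 else 0.

(* Coefficients of h(T; pi) = exp(l(pi T)). *)
Definition h_coef (p : nat) (pi : K) : nat -> K :=
  fps_exp (fun i => l_coef p i * pi ^+ i).

(* f(T^d), as a two-sided series *)
Definition subst_pow (f : nat -> K) (d : nat) : int -> K :=
  fun n => if n is Posz m then (if (d %| m)%N then f (m %/ d)%N else 0) else 0.

End FormalExponential.

Section AnalyticSeries.
Context {R : realType} {K : fieldType}.
Variable abs : K -> R.

Definition strictly_integral (A : set (int -> K)) : Prop :=
  exists2 v, is_standard_basis A v & forall i (j : int), abs (v i j) <= 1.

Definition Hfield : set (int -> K) :=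
  [set a | has_ubound (range (fun i => abs (a i))) /\
           (fun n : nat => abs (a n%:Z)) @ \oo --> (0 : R)].

Definition hnorm (a : int -> K) : R := sup (range (fun i => abs (a i))).

Definition has_sum (f : int -> K) (s : K) : Prop :=
  (fun n : nat => abs (\sum_(i < n.*2.+1) f (i%:Z - n%:Z) - s))
    @ \oo --> (0 : R).

(* the sum over Z of a convergent family, through symmetric partial sums *)
Definition zsum (f : int -> K) : K := xget 0 [set s | has_sum f s].

Definition hmul (a b : int -> K) : int -> K :=
  fun n => zsum (fun i => a i * b (n - i)).

Definition units_of (B : set (int -> K)) : set (int -> K) :=
  [set u | B u /\ exists2 w, B w & hmul u w = one_series].

Definition closure_H (A : set (int -> K)) : set (int -> K) :=
  [set h | Hfield h /\ forall e : R, 0 < e ->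
             exists a, [/\ A a, Hfield a & hnorm (h - a) < e]].

Definition Gamma_at (rho : R) : set (int -> K) :=
  [set h | [/\ units_of Hfield h, hnorm h = 1, abs (h 0) = 1
             & forall i : nat, (0 < i)%N -> abs (h i%:Z) <= rho ^+ i]].

Definition Gamma : set (int -> K) :=
  [set h | exists rho : R, [/\ 0 <= rho, rho < 1 & Gamma_at rho h]].

(* The subgroup ((A^an)^* /\ Gamma) Gamma_0 of Gamma, its cosets, and the
   quotient Gamma_A as the set of these cosets. *)
Definition Gamma_sub (A : set (int -> K)) : set (int -> K) :=
  [set h | exists u c, [/\ units_of (closure_H A) u, Gamma u, Gamma_at 0 c
                         & h = hmul u c]].

Definition Gamma_class (A : set (int -> K)) (h : int -> K) : set (int -> K) :=
  [set hmul h n | n in Gamma_sub A].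

Definition Gamma_quot (A : set (int -> K)) : set (set (int -> K)) :=
  [set Gamma_class A h | h in Gamma].

Definition h_mu (p g : nat) (mu : 'I_g -> nat) (pi : 'I_g -> K) : int -> K :=
  \big[hmul/one_series]_(i < g) subst_pow (h_coef p (pi i)) (mu i).

Definition maximal_ideal_pow (g : nat) : set ('I_g -> K) :=
  [set pi | forall i, abs (pi i) < 1].

End AnalyticSeries.

Arguments maximal_ideal_pow {R K} abs g.

(* Main.v *)
Require Import Defs.
From HB Require Import structures.
From mathcomp Require Import all_boot all_order all_algebra all_field.
From mathcomp Require Import all_classical all_reals all_analysis.
From mathcomp Require Import ring lra zify.

(* Suppose that h = h' u c with h = h_mu(pi), h' = h_mu(pi'), u in A^an and
   c in Gamma_0, and that d = max_i |pi_i - pi'_i| > 0. The Artin-Hasse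
   exponential 1 + T + ... has p-integral coefficients, so h - h' equals
   D = sum_i (pi_i - pi'_i) T^mu_i up to an error of norm < d, and hence so does
   u c - 1. In positive degrees u is small; as A is strictly integral, u, and
   therefore c, is congruent to a constant modulo M_K. It follows that in
   positive degrees u c - c_0 u, and then D - c_0 u, has norm < d. Now D vanishes
   at the degrees s_i of A, so |u_(s_i)| < d, and strict integrality bounds all
   the coefficients of u, in particular those at the gaps, by these. Hence
   |pi_i - pi'_i| < d for all i, a contradiction. *)

Set Implicit Arguments.
Unset Strict Implicit.
Unset Printing Implicit Defensive.

Import Order.TTheory GRing.Theory Num.Theory.
Import numFieldNormedType.Exports.
Local Open Scope classical_set_scope.
Local Open Scope ring_scope.

(** * Non-archimedean absolute values *)

Lemma cvg_abs0P (R : realType) (F : fieldType) (abs : F -> R)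
    (abs_ge0 : forall x, 0 <= abs x) (u : nat -> F) :
  ((fun n => abs (u n)) @ \oo --> (0 : R)) <->
  (forall e : R, 0 < e -> exists N, forall n, (N <= n)%N -> abs (u n) < e).
Proof.
split=> [/cvgr0Pnorm_lt cu e e0|cu].
  have [N _ hN] := cu e e0; exists N => n Nn.
  by have := hN n Nn; rewrite /= ger0_norm.
apply/cvgr0Pnorm_lt => e e0; have [N hN] := cu e e0.
exists N => // n /= Nn; rewrite ger0_norm //; exact: hN.
Qed.

Section AbsoluteValue.
Context {R : realType} {F : fieldType} {abs : F -> R}.
Hypothesis absP : absolute_value abs.
Implicit Types (x y : F) (M : R).

Let abs_ge0 := absv_ge0 absP.

Lemma absv0 : abs 0 = 0. Proof. exact/(absv_eq0 absP). Qed.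

Lemma absv_gt0 x : x != 0 -> 0 < abs x.
Proof.
move=> /eqP x0; rewrite lt_neqAle abs_ge0 andbT eq_sym.
by apply/eqP => /(absv_eq0 absP).
Qed.

Lemma absv1 : abs 1 = 1.
Proof.
have := absvM absP 1 1; rewrite mulr1 => /eqP; rewrite -subr_eq0 => h.
have a0 := absv_gt0 (oner_neq0 F); apply/eqP.
by move: h; rewrite -{1}[abs 1]mulr1 -mulrBr mulf_eq0 gt_eqF //= subr_eq0 eq_sym.
Qed.

Lemma absvN x : abs (- x) = abs x.
Proof.
suff h : abs (-1) = 1 by rewrite -mulN1r (absvM absP) h mul1r.
apply/eqP; rewrite -(@eqrXn2 _ 2) //; first by apply/eqP; rewrite expr1n expr2 -(absvM absP) mulrNN mulr1 absv1.
Qed.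

Lemma absv_distC x y : abs (x - y) = abs (y - x).
Proof. by rewrite -absvN opprB. Qed.

Lemma absv_leD x y M : abs x <= M -> abs y <= M -> abs (x + y) <= M.
Proof.
by move=> hx hy; rewrite (le_trans (absv_ultra absP x y)) // ge_max hx hy.
Qed.

Lemma absv_leB x y M : abs x <= M -> abs y <= M -> abs (x - y) <= M.
Proof. by move=> hx hy; rewrite absv_leD // absvN. Qed.

Lemma absv_ltD x y M : abs x < M -> abs y < M -> abs (x + y) < M.
Proof.
by move=> hx hy; rewrite (le_lt_trans (absv_ultra absP x y)) // gt_max hx hy.
Qed.

Lemma absv_ltB x y M : abs x < M -> abs y < M -> abs (x - y) < M.
Proof. by move=> hx hy; rewrite absv_ltD // absvN. Qed.

Lemma absv_sum_le (I : Type) (r : seq I) (P : pred I) (f : I -> F) M :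
  0 <= M -> (forall i, P i -> abs (f i) <= M) -> abs (\sum_(i <- r | P i) f i) <= M.
Proof.
move=> M0 hf; elim/big_ind : _ => //; first by rewrite absv0.
by move=> x y; exact: absv_leD.
Qed.

Lemma absvX x n : abs (x ^+ n) = abs x ^+ n.
Proof. by elim: n => [|n IH]; rewrite ?expr0 ?absv1 // !exprS (absvM absP) IH. Qed.

Lemma absvM_le x y a b : abs x <= a -> abs y <= b -> abs (x * y) <= a * b.
Proof. by move=> hx hy; rewrite (absvM absP) ler_pM. Qed.

Lemma absv_natr n : abs n%:R <= 1.
Proof.
elim: n => [|n IH]; first by rewrite absv0.
by rewrite -addn1 natrD absv_leD // absv1.
Qed.

Lemma absv_isosceles x y : abs (y - x) < abs x -> abs y = abs x.
Proof.
move=> h; apply/eqP; rewrite eq_le; apply/andP; split.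
  by rewrite -[y](subrK x) absv_leD // ltW.
rewrite leNgt; apply/negP => yx; suff : abs x < abs x by rewrite ltxx.
by rewrite -{1}[x](subKr y) absv_ltB.
Qed.

End AbsoluteValue.

Section Completeness.
Context {R : realType} {Qp : fieldType} {absQ : Qp -> R}.
Context {K : fieldExtType Qp} {abs : K -> R}.
Hypotheses (absQP : absolute_value absQ) (absP : absolute_value abs).
Hypothesis abs_ext : forall a : Qp, abs a%:A = absQ a.
Hypothesis Qp_complete : abs_complete absQ.

Let cauchy (u : nat -> K) := forall e : R, 0 < e -> exists N : nat,
  forall m n : nat, (N <= m)%N -> (N <= n)%N -> abs (u m - u n) < e.
Let cv (u : nat -> K) l := forall e : R, 0 < e -> exists N : nat,
  forall n : nat, (N <= n)%N -> abs (u n - l) < e.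
Let vcomplete (W : {vspace K}) := forall u, (forall n, u n \in W) -> cauchy u ->
  exists2 l, l \in W & cv u l.

Let absZ (a : Qp) (x : K) : abs (a *: x) = absQ a * abs x.
Proof. by rewrite -[x in LHS]mul1r scalerAl (absvM absP) abs_ext. Qed.

Lemma vcomplete_dist W e : vcomplete W -> e \notin W ->
  exists2 d : R, 0 < d & forall w, w \in W -> d <= abs (e - w).
Proof.
move=> Wc eW; apply: contrapT => H.
have H' (n : nat) : exists w, w \in W /\ abs (e - w) < n.+1%:R^-1.
  apply: contrapT => Hn; apply: H; exists n.+1%:R^-1; first by rewrite invr_gt0.
  move=> w wW; rewrite leNgt; apply/negP => ?; apply: Hn; by exists w.
have [w hw] := choice H'.
have small (d : R) : 0 < d -> exists N, forall n, (N <= n)%N -> abs (e - w n) < d.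
  move=> d0; exists (Num.truncn d^-1) => n hn; have [_ h] := hw n; apply: (lt_trans h).
  rewrite invf_plt ?posrE //; apply: lt_le_trans (truncnS_gt _) _.
  by rewrite ler_nat.
have [n|d d0|l lW wl] := Wc w.
- by case: (hw n).
- have [N hN] := small d d0; exists N => m n hm hn.
  have -> : w m - w n = (e - w n) - (e - w m) by ring.
  by apply: (absv_ltB absP); apply: hN.
suff el : e = l by rewrite el lW in eW.
apply/eqP; rewrite -subr_eq0; apply/negPn/negP => /(absv_gt0 absP) d0.
have [N1 h1] := small _ d0; have [N2 h2] := wl _ d0.
have := absv_ltD absP (h1 _ (leq_maxl N1 N2)) (h2 _ (leq_maxr N1 N2)).
by rewrite subrKA ltxx.
Qed.

Lemma vcomplete_add_line W e : vcomplete W -> vcomplete (<[e]> + W)%VS.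
Proof.
move=> Wc; have [eW|eW] := boolP (e \in W).
  by have /addv_idPr -> : (<[e]> <= W)%VS.
have [d d0 hd] := vcomplete_dist Wc eW.
move=> u uW uc.
have H' n : exists xw : Qp * K, xw.2 \in W /\ u n = xw.1 *: e + xw.2.
  have /memv_addP[_ /vlineP[x ->] [w wW ->]] := uW n; by exists (x, w).
have [xw hxw] := choice H'; pose x n := (xw n).1; pose w n := (xw n).2.
have wW n : w n \in W by case: (hxw n).
have uE n : u n = x n *: e + w n by case: (hxw n).
have e0 : 0 < abs e.
  by apply: (absv_gt0 absP); apply: contraNneq eW => ->; rewrite mem0v.
have xu m n : absQ (x m - x n) * d <= abs (u m - u n).
  have [->|ne] := eqVneq (x m) (x n).
    by rewrite subrr (absv0 absQP) mul0r (absv_ge0 absP).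
  have ne' : x m - x n != 0 by rewrite subr_eq0.
  have -> : u m - u n = (x m - x n) *: (e - (x m - x n)^-1 *: (w n - w m)).
    rewrite scalerBr scalerA divff // scale1r scalerBl !uE opprB.
    by rewrite opprD addrACA.
  rewrite absZ ler_wpM2l ?(absv_ge0 absQP) // hd //.
  by rewrite memvZ // memvB.
have [|lx lxP] := @Qp_complete x.
  move=> t t0; have [|N hN] := uc (t * d); first by rewrite mulr_gt0.
  exists N => m n hm hn; rewrite -(ltr_pM2r d0).
  by apply: le_lt_trans (xu m n) _; apply: hN.
move/(cvg_abs0P (absv_ge0 absQP)): lxP => lxP.
have [||lw lwW lwP] := Wc w; first exact: wW.
  move=> t t0; have [N1 h1] := uc t t0.
  have [|N2 h2] := lxP (t / abs e); first by rewrite divr_gt0.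
  exists (maxn N1 N2) => m n; rewrite !geq_max => /andP[m1 m2] /andP[n1 n2].
  have -> : w m - w n = (u m - u n) - ((x m - lx) *: e - (x n - lx) *: e).
    by rewrite !uE !scalerBl; move: (x m *: e) (x n *: e) (lx *: e) => a b c; ring.
  apply: (absv_ltB absP); first exact: h1.
  by apply: (absv_ltB absP); rewrite absZ -ltr_pdivlMr //; apply: h2.
exists (lx *: e + lw); first by rewrite memv_add // memvZ // memv_line.
move=> t t0; have [|N1 h1] := lxP (t / abs e); first by rewrite divr_gt0.
have [N2 h2] := lwP t t0.
exists (maxn N1 N2) => n; rewrite geq_max => /andP[n1 n2].
rewrite uE opprD addrACA -scalerBl; apply: (absv_ltD absP); last exact: h2.
by rewrite absZ -ltr_pdivlMr //; apply: h1.
Qed.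

Lemma fieldExt_complete : abs_complete abs.
Proof.
have sc (s : seq K) : vcomplete (span s).
  elim: s => [|e s IH]; last by rewrite span_cons; exact: vcomplete_add_line.
  move=> u u0 _; exists 0; first by rewrite mem0v.
  move=> t t0; exists 0%N => n _; have := u0 n.
  by rewrite span_nil memv0 subr0 => /eqP ->; rewrite (absv0 absP).
move=> u uc; have [|//|l _ lP] := sc (vbasis (fullv : {vspace K})) u.
  by move=> n; rewrite (span_basis (vbasisP _)) memvf.
by exists l; apply/(cvg_abs0P (absv_ge0 absP)).
Qed.

End Completeness.

(** * Integrality of the Artin-Hasse exponential *)

Section TruncatedEquality.
Context {K : fieldType}.
Implicit Types (a b c d : {poly K}) (N : nat).

Definition eq_upto N a b := forall i, (i <= N)%N -> a`_i = b`_i.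

Lemma eq_uptoM N a b c d :
  eq_upto N a b -> eq_upto N c d -> eq_upto N (a * c) (b * d).
Proof.
move=> ab cd i iN; rewrite !coefM; apply: eq_bigr => j _.
have := ltn_ord j; rewrite ltnS => ji.
by rewrite ab ?cd // (leq_trans _ iN) // leq_subr.
Qed.

Lemma eq_uptoX N a b n : eq_upto N a b -> eq_upto N (a ^+ n) (b ^+ n).
Proof.
move=> ab; elim: n => [|n IH]; first by rewrite !expr0.
by rewrite !exprS; exact: eq_uptoM.
Qed.

End TruncatedEquality.

Lemma logn_fact_lt p n : prime p -> (0 < n)%N -> (logn p n`! < n)%N.
Proof.
move=> pp; rewrite logn_fact // big_add1 /= => n0.
suff H m k : (0 < k)%N -> (\sum_(0 <= i < m) k %/ p ^ i.+1 < k)%N by exact: H.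
elim: m k {n n0} => [|m IH] n n0; first by rewrite big_nil.
rewrite big_nat_recl // expn1.
under eq_bigr do rewrite expnS divnMA.
have p1 := prime_gt1 pp.
have [->|q0] := posnP (n %/ p)%N.
  by rewrite big1 ?addn0 // => i _; rewrite div0n.
have := IH _ q0; rewrite -(ltn_add2l (n %/ p)) => /leq_trans; apply.
rewrite addnn -muln2 (leq_trans _ (leq_trunc_div n p)) // leq_mul2l p1 orbT //.
Qed.

Lemma frobenius_add (T : comNzRingType) (B : T -> Prop) p (x y : T) :
  prime p -> B 0 -> B 1 -> (forall a b, B a -> B b -> B (a + b)) ->
  (forall a b, B a -> B b -> B (a * b)) -> B x -> B y ->
  exists2 z, B z & (x + y) ^+ p = x ^+ p + y ^+ p + z *+ p.
Proof.
move=> pp B0 B1 BD BM Bx By.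
have BX a n : B a -> B (a ^+ n).
  by move=> Ba; elim: n => [|n IH]; rewrite ?expr0 // exprS; exact: BM.
have BMn a n : B a -> B (a *+ n).
  by move=> Ba; elim: n => [|n IH]; rewrite ?mulr0n // mulrS; exact: BD.
exists (\sum_(1 <= i < p) x ^+ (p - i) * y ^+ i *+ ('C(p, i) %/ p)).
  by elim/big_ind : _ => // i _; apply: BMn; apply: BM; exact: BX.
rewrite exprDn -(big_mkord xpredT (fun i => x ^+ (p - i) * y ^+ i *+ 'C(p, i))).
have p0 := prime_gt0 pp; rewrite big_nat_recr //= big_ltn //.
rewrite subn0 subnn !expr0 mulr1 mul1r bin0 binn !mulr1n -addrA [X in _ + X]addrC addrA.
congr (_ + _); rewrite -sumrMnl big_nat_cond [RHS]big_nat_cond.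
apply: eq_bigr => i; rewrite andbT => hi.
by rewrite -mulrnA divnK // prime_dvd_bin.
Qed.

Section ArtinHasse.
Context {R : realType} {K : fieldType} {abs : K -> R} (p : nat).
Hypothesis absP : absolute_value abs.
Hypothesis p_prime : prime p.
Hypothesis abs_nat : forall n, (0 < n)%N -> abs n%:R = (p ^ logn p n)%:R^-1.

Let p_gt0 := prime_gt0 p_prime.
Let p_gt1 := prime_gt1 p_prime.
Let abs_ge0 := absv_ge0 absP.

Lemma natr_neq0 n : (0 < n)%N -> n%:R != 0 :> K.
Proof.
move=> n0; apply/eqP => n00; have := abs_nat n0.
rewrite n00 (absv0 absP) => /esym/eqP.
by rewrite invr_eq0 pnatr_eq0 expn_eq0 -leqn0 leqNgt p_gt0.
Qed.

Let e : nat -> K := fps_exp (l_coef p).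
Let L (i : nat) : K := (i == p ^ logn p i)%N%:R.
Let LP N : {poly K} := \poly_(i < N.+1) L i.
Let P N : {poly K} := \poly_(i < N.+1) l_coef p i.
Let E N : {poly K} := \sum_(n < N.+1) (n`!%:R^-1 : K) *: P N ^+ n.

Lemma l_coef0 : l_coef p 0 = 0 :> K.
Proof. by rewrite /l_coef logn0 expn0. Qed.

Lemma l_coefM (i : nat) : i%:R * l_coef p i = L i.
Proof.
rewrite /l_coef /L; case: ifP => [/eqP h|]; last by rewrite mulr0.
rewrite {1}h natrX divff // -natrX natr_neq0 // expn_gt0 p_gt0 //.
Qed.

Let PX N : P N = 'X * \poly_(i < N) l_coef p i.+1.
Proof.
apply/polyP => i; rewrite coefXM !coef_poly.
by case: i => [|i] /=; rewrite ?l_coef0.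
Qed.

Let PXn N n i : (i < n)%N -> (P N ^+ n)`_i = 0.
Proof. by move=> i_n; rewrite PX exprMn_comm ?coefXnM ?i_n //; exact: mulrC. Qed.

Let E_coef m N : (m <= N)%N -> (E N)`_m = e m.
Proof.
move=> mN; rewrite /E /e /fps_exp !coef_sum.
rewrite -(subnKC mN) -addSn big_split_ord /= [X in _ + X]big1 ?addr0.
  apply: eq_bigr => i _; rewrite !coefZ; congr (_ * _).
  apply: (@eq_uptoX _ m) => // j jm; rewrite !coef_poly !ltnS jm.
  by rewrite (leq_trans jm) // leq_addr.
by move=> i _; rewrite coefZ PXn ?mulr0 // ltnS leq_addr.
Qed.

Lemma fps_exp_l0 : e 0 = 1.
Proof. by rewrite /e /fps_exp big_ord1 expr0 fact0 invr1 scale1r coef1. Qed.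

Lemma fps_exp_l_rec m : m%:R * e m = \sum_(i < m.+1) L i * e (m - i).
Proof.
have dE : 'X * (E m)^`() = 'X * (P m)^`() * E m -
    (m`!%:R^-1 *: ('X * (P m)^`() * P m ^+ m)).
  rewrite {1}/E raddf_sum big_ord_recl /= derivZ expr0 derivC scaler0 add0r.
  rewrite /E big_ord_recr /= [in RHS]mulrDr -!scalerAr addrK mulr_sumr mulr_sumr.
  apply: eq_bigr => i _; rewrite derivZ deriv_exp /= -!scalerAr -mulrA.
  rewrite mulrnAr -scaler_nat scalerA /bump add1n factS natrM invfM mulrAC.
  by rewrite mulVf ?mul1r // natr_neq0.
have XP i : (i <= m)%N -> ('X * (P m)^`())`_i = L i.
  move=> im; rewrite coefXM; case: i im => [|i] im /=.
    by rewrite -l_coefM mul0r.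
  by rewrite coef_deriv coef_poly ltnS im -l_coefM mulr_natl.
have := congr1 (fun q : {poly K} => q`_m) dE.
rewrite coefB coefZ [X in _ - _ * X]coefM big1 ?mulr0 ?subr0; last first.
  move=> i _; have := ltn_ord i; rewrite ltnS leq_eqVlt => /orP[/eqP ->|im].
    by rewrite subnn; case: (m) (PXn) => [|k] PX'; rewrite ?coefXM ?mul0r // PX' // mulr0.
  case: (posnP i) => [->|i0]; first by rewrite coefXM mul0r.
  by rewrite PXn ?mulr0 // ltn_subrL i0 (leq_trans _ im).
rewrite coefXM => dE'; transitivity ((E m)^`() * 'X)`_m.
  rewrite coefMX; case: (m) (@E_coef) => [|k] hE; first by rewrite mul0r.
  by rewrite coef_deriv hE //= mulr_natl.
rewrite mulrC coefXM dE' coefM; apply: eq_bigr => i _.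
by rewrite (XP _ (ltn_ord i)) (E_coef (leq_subr _ _)).
Qed.


Let frac (x : K) := exists a b : nat, (0 < b)%N /\ b%:R * x = a%:R.

Lemma fps_exp_l_frac n : frac (e n).
Proof.
have fracD x y : frac x -> frac y -> frac (x + y).
  move=> [a [b [b0 hx]]] [c [d [d0 hy]]]; exists (a * d + c * b)%N, (b * d)%N.
  by split; [rewrite muln_gt0 b0|rewrite natrD !natrM -hx -hy; ring].
elim/ltn_ind: n => -[|n] IH; first by exists 1%N, 1%N; rewrite fps_exp_l0 mulr1.
have : frac (n.+1%:R * e n.+1).
  rewrite fps_exp_l_rec; elim/big_ind : _ => //; first by exists 0%N, 1%N; rewrite mulr0.
  move=> i _; rewrite /L; case: i => -[|i] /= hi.
    by exists 0%N, 1%N; rewrite logn0 expn0 mul0r mulr0.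
  have [a [b [b0 hx]]] := IH (n.+1 - i.+1)%N (ltn_subrL _ _).
  exists ((i.+1 == p ^ logn p i.+1)%N * a)%N, b; split => //.
  by rewrite natrM -hx; ring.
move=> [a [b [b0 hx]]]; exists a, (b * n.+1)%N.
by rewrite muln_gt0 b0; split => //; rewrite natrM -mulrA.
Qed.

Lemma abs_p : abs p%:R = p%:R^-1.
Proof. by rewrite abs_nat // logn_prime // eqxx expn1. Qed.

Lemma frobenius_congr x y : abs x <= 1 -> abs y <= 1 ->
  abs ((x + y) ^+ p - x ^+ p - y ^+ p) <= p%:R^-1.
Proof.
move=> hx hy.
have [||||z z1 ->] := @frobenius_add K (fun x => abs x <= 1) p x y p_prime _ _ _ _ hx hy.
- by rewrite (absv0 absP).
- by rewrite (absv1 absP).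
- by move=> a b; exact: (absv_leD absP).
- by move=> a b ha hb; rewrite -[1]mulr1; exact: (absvM_le absP).
rewrite (_ : _ - _ - _ = p%:R * z); last by rewrite mulr_natl; ring.
rewrite (absvM absP) abs_p.
by rewrite ler_piMr // invr_ge0.
Qed.

Lemma fermat_frac x : frac x -> abs x <= 1 -> abs (x ^+ p - x) <= p%:R^-1.
Proof.
have pV0 : 0 <= p%:R^-1 :> R by rewrite invr_ge0.
have fermat_nat (n : nat) : abs (n%:R ^+ p - n%:R) <= p%:R^-1.
  elim: n => [|n IH]; first by rewrite expr0n gtn_eqF // subrr (absv0 absP).
  have -> : n.+1%:R ^+ p - n.+1%:R = ((n%:R + 1) ^+ p - n%:R ^+ p - 1 ^+ p) +
      (n%:R ^+ p - n%:R) :> K by rewrite expr1n -natr1; ring.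
  by apply: (absv_leD absP) => //; rewrite frobenius_congr ?(absv_natr absP) ?(absv1 absP).
move=> [a [b [b0 hx]]] x1.
case: (posnP a) => [a0|a0].
  suff -> : x = 0 by rewrite expr0n gtn_eqF // subrr (absv0 absP).
  by apply/eqP; move/eqP: hx; rewrite a0 mulf_eq0 (negPf (natr_neq0 b0)).
have [b' cb bE] := pfactor_coprime p_prime b0.
have [a' ca aE] := pfactor_coprime p_prime a0.
have ab : (logn p b <= logn p a)%N.
  rewrite -(leq_exp2l _ _ p_gt1) -(ler_nat R) -lef_pV2 ?posrE ?ltr0n ?expn_gt0 ?p_gt0 //.
  by rewrite -!abs_nat // -hx (absvM absP) ler_piMr.
have {}hx : b'%:R * x = (a' * p ^ (logn p a - logn p b))%:R.
  apply: (mulfI (@natr_neq0 (p ^ logn p b) _)); first by rewrite expn_gt0 p_gt0.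
  rewrite mulrA -!natrM [(_ * b')%N]mulnC -bE hx mulnCA -expnD subnKC //.
  by rewrite -aE.
move: (a' * _)%N hx => {a0 ca aE ab} a hx {a'}.
have b'0 : (0 < b')%N by rewrite lt0n; apply: contraTneq b0 => b'0; rewrite bE b'0.
have b'1 : abs b'%:R = 1.
  rewrite abs_nat // (_ : logn p b' = 0%N) ?invr1 //.
  by rewrite lognE p_prime b'0 -[(p %| b')%N]negbK -prime_coprime // cb.
suff : abs (b'%:R ^+ p * (x ^+ p - x)) <= p%:R^-1.
  by rewrite (absvM absP) (absvX absP) b'1 expr1n mul1r.
have -> : b'%:R ^+ p * (x ^+ p - x) =
    (a%:R ^+ p - a%:R) - x * (b'%:R ^+ p - b'%:R).
  by rewrite -hx exprMn; ring.
apply: (absv_leB absP) => //.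
by rewrite (absvM absP) (le_trans _ (fermat_nat b')) // ler_piMl.
Qed.

Let bd M (q : {poly K}) := forall i, abs q`_i <= M.

Let bdM M q r : 0 <= M -> bd 1 q -> bd M r -> bd M (q * r).
Proof.
move=> M0 hq hr i; rewrite coefM; apply: (absv_sum_le absP) => // j _.
by rewrite -[M]mul1r; exact: (absvM_le absP).
Qed.

Let bdD M q r : bd M q -> bd M r -> bd M (q + r).
Proof. by move=> hq hr i; rewrite coefD; exact: (absv_leD absP). Qed.

Lemma poly_frobenius_congr n (f : nat -> K) :
  (forall i, (i < n)%N -> abs (f i) <= 1 /\ abs (f i ^+ p - f i) <= p%:R^-1) ->
  bd p%:R^-1 ((\poly_(i < n) f i) ^+ p - ((\poly_(i < n) f i) \Po 'X^p)).
Proof.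
have pV0 : 0 <= p%:R^-1 :> R by rewrite invr_ge0.
elim: n => [|n IH] hf.
  by rewrite poly_def big_ord0 comp_poly0 expr0n gtn_eqF // subrr => i; rewrite coef0 (absv0 absP).
rewrite poly_def big_ord_recr /= -poly_def.
set g := \poly_(i < n) f i; set y := f n *: 'X^n.
have Zbd (c : K) k M : 0 <= M -> abs c <= M -> bd M (c *: 'X^k).
  move=> M0 hc i; rewrite coefZ coefXn; case: eqP; rewrite ?mulr1 // mulr0.
  by rewrite (absv0 absP).
have [fn1 fnp] := hf n (ltnSn n).
have [||||||z z1 ->] := @frobenius_add {poly K} (bd 1) p g y p_prime.
- by move=> i; rewrite coef0 (absv0 absP).
- by move=> i; rewrite coef1; case: eqP => _; rewrite ?(absv1 absP) ?(absv0 absP).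
- by move=> a b; exact: bdD.
- by move=> a b; exact: bdM.
- by move=> i; rewrite coef_poly; case: ifP => h; [case: (hf i) => //; rewrite ltnW|rewrite (absv0 absP)].
- exact: Zbd.
have -> : g ^+ p + y ^+ p + z *+ p - ((g + y) \Po 'X^p) =
    (g ^+ p - (g \Po 'X^p)) + ((f n ^+ p - f n) *: 'X^(n * p) + z *+ p).
  have -> : (g + y) \Po 'X^p = (g \Po 'X^p) + f n *: 'X^(n * p).
    by rewrite comp_polyD /y comp_polyZ comp_Xn_poly -exprM mulnC.
  rewrite scalerBl /y exprZn -exprM; move: (g \Po 'X^p) (f n *: 'X^(n * p)) => a b; ring.
apply: bdD; first by apply: IH => i hi; apply: hf; rewrite ltnW.
apply: bdD; first exact: Zbd.
move=> i; rewrite coefMn -[X in abs X]mulr_natl (absvM absP) abs_p.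
by rewrite ler_piMr.
Qed.

Let L0 : L 0 = 0.
Proof. by rewrite /L logn0 expn0. Qed.

Let L_rec i : L i = (if (p %| i)%N then L (i %/ p) else 0) + (i == 1)%N%:R.
Proof.
case: (posnP i) => [->|i0]; first by rewrite dvdn0 div0n L0 add0r.
rewrite /L; case: ifP => pi; last first.
  by rewrite add0r lognE p_prime i0 pi expn0.
have -> : (i == 1)%N = false.
  by apply/negP => /eqP i1; move: pi; rewrite i1 dvdn1 gtn_eqF.
case/dvdnP: pi i0 => k ->; rewrite muln_gt0 => /andP[k0 _].
rewrite addr0 mulnK // lognM // [logn p p]logn_prime // eqxx addn1 expnSr.
by rewrite eqn_pmul2r.
Qed.

Lemma eq_upto_ode N (G H : {poly K}) : G`_0 = H`_0 ->
  eq_upto N ('X * G^`()) (p%:R *: (LP N * G)) ->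
  eq_upto N ('X * H^`()) (p%:R *: (LP N * H)) -> eq_upto N G H.
Proof.
move=> GH0 hG hH i; elim/ltn_ind: i => -[//|i] IH iN.
have odeE (Q : {poly K}) : eq_upto N ('X * Q^`()) (p%:R *: (LP N * Q)) ->
    i.+1%:R * Q`_i.+1 = p%:R * \sum_(j < i.+1) L j.+1 * Q`_(i - j).
  move=> /(_ _ iN); rewrite coefXM /= coef_deriv mulr_natl => ->.
  rewrite coefZ coefM big_ord_recl coef_poly /= L0 mul0r add0r; congr (_ * _).
  apply: eq_bigr => j _; rewrite coef_poly /bump add1n subSS ifT //.
  by rewrite ltnS (leq_trans (ltn_ord j)) // ltnW.
apply: (mulfI (natr_neq0 (ltn0Sn i))); rewrite !odeE //; congr (_ * _).
apply: eq_bigr => j _; rewrite IH //; first by rewrite ltnS leq_subr.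
by rewrite (leq_trans (leq_subr _ _)) // ltnW.
Qed.

Let F N : {poly K} := \poly_(i < N.+1) e i.
Let Ex N : {poly K} := \poly_(i < N.+1) (p%:R ^+ i / i`!%:R).

Let F_ode N : eq_upto N ('X * (F N)^`()) (LP N * F N).
Proof.
move=> i iN; rewrite [RHS]coefM.
transitivity (i%:R * e i).
  rewrite coefXM; case: i iN => [|i] iN /=; first by rewrite mul0r.
  by rewrite coef_deriv coef_poly ltnS iN mulr_natl.
rewrite fps_exp_l_rec; apply: eq_bigr => j _; rewrite !coef_poly !ltnS.
have ji := ltn_ord j; rewrite ltnS in ji.
by rewrite (leq_trans ji iN) (leq_trans (leq_subr _ _) iN).
Qed.

(* With f the Artin-Hasse series, both sides solve X y' = p (sum_k X^(p^k)) y. *)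
Lemma dwork_equation N : eq_upto N (F N ^+ p) ((F N \Po 'X^p) * Ex N).
Proof.
have F0 : (F N)`_0 = 1 by rewrite coef_poly /= fps_exp_l0.
apply: eq_upto_ode.
- rewrite coefM big_ord1 coef_comp_poly_Xn // dvdn0 div0n F0 coef_poly /=.
  rewrite expr0 fact0 invr1 !mulr1 -horner_coef0 horner_exp.
  by rewrite horner_coef0 F0 expr1n.
- have -> : 'X * (F N ^+ p)^`() = (p%:R *: F N ^+ p.-1) * ('X * (F N)^`()).
    rewrite deriv_exp -[X in 'X * X]scaler_nat -scalerAr -scalerAl; congr (_ *: _); ring.
  have -> : p%:R *: (LP N * F N ^+ p) = (p%:R *: F N ^+ p.-1) * (LP N * F N).
    have -> : F N ^+ p = F N * F N ^+ p.-1 by rewrite -exprS prednK.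
    rewrite -scalerAl; congr (_ *: _); ring.
  by apply: eq_uptoM.
have -> : 'X * ((F N \Po 'X^p) * Ex N)^`() =
    p%:R *: ((('X * (F N)^`()) \Po 'X^p) * Ex N) + (F N \Po 'X^p) * ('X * (Ex N)^`()).
  rewrite derivM deriv_comp derivXn comp_polyM comp_polyX -[X in (_ \Po _) * X]scaler_nat.
  have -> : ('X^p : {poly K}) = 'X * 'X^(p.-1) by rewrite -exprS prednK.
  rewrite -scalerAr -scalerAl mulrDr -scalerAr; congr (_ *: _ + _); ring.
have -> : p%:R *: (LP N * ((F N \Po 'X^p) * Ex N)) =
    (F N \Po 'X^p) * Ex N * (p%:R *: LP N).
  by rewrite -scalerAr; congr (_ *: _); ring.
have eqX : eq_upto N (('X * (F N)^`()) \Po 'X^p) ((LP N * F N) \Po 'X^p).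
  move=> i iN; rewrite !coef_comp_poly_Xn //; case: ifP => // _.
  by rewrite F_ode // (leq_trans (leq_div _ _)).
have eqE : eq_upto N ('X * (Ex N)^`()) (p%:R *: 'X * Ex N).
  move=> i iN; rewrite -scalerAl coefZ !coefXM; case: i iN => [|i] iN /=; first by rewrite mulr0.
  rewrite coef_deriv !coef_poly !ltnS iN ltnW // exprS factS natrM.
  by rewrite -mulr_natl invfM; field; rewrite !natr_neq0 ?fact_gt0 //; rewrite nat1r natr_neq0.
have eqL : eq_upto N (LP N) ((LP N \Po 'X^p) + 'X).
  move=> i iN; rewrite coefD coef_comp_poly_Xn // !coef_poly coefX ltnS iN L_rec.
  by rewrite ltnS (leq_trans (leq_div _ _)).
move=> i iN.
rewrite (@eq_uptoM _ N _ _ _ _ (fun _ _ => erefl) (_ : eq_upto N (p%:R *: LP N) (p%:R *: ((LP N \Po 'X^p) + 'X)))) //; last first.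
  by move=> j jN; rewrite !coefZ eqL.
rewrite coefD coefZ (eq_uptoM eqX (fun _ _ => erefl)) //.
rewrite (eq_uptoM (fun _ _ => erefl) eqE) // -coefZ -coefD.
apply: (congr1 (fun q : {poly K} => q`_i)).
rewrite comp_polyM -!mul_polyC; ring.
Qed.

Lemma fps_exp_l_integral n : abs (e n) <= 1.
Proof.
have pV0 : 0 <= p%:R^-1 :> R by rewrite invr_ge0.
elim/ltn_ind: n => -[|n] IH; first by rewrite fps_exp_l0 (absv1 absP).
set N := n.+1; pose g := \poly_(i < N) e i.
have FE : F N = g + e N *: 'X^N by rewrite /F poly_def big_ord_recr /= -poly_def.
have g0 : g`_0 = 1 by rewrite coef_poly fps_exp_l0.
have F0 : (F N)`_0 = 1 by rewrite coef_poly fps_exp_l0.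
have h1 : (F N ^+ p)`_N = (g ^+ p)`_N + p%:R * e N.
  apply/eqP; rewrite addrC -subr_eq -coefB subrXX FE addrC addKr -scalerAl coefZ.
  rewrite coefXnM ltnn subnn coef_sum mulrC; apply/eqP; congr (_ * _).
  rewrite -[RHS]mulr_natl mulr1 -[p in RHS]card_ord -sumr_const; apply: eq_bigr => i _.
  rewrite -FE -!horner_coef0 hornerM !horner_exp !horner_coef0 g0 F0.
  by rewrite !expr1n mulr1.
have h2 : ((F N \Po 'X^p) * Ex N)`_N = (g \Po 'X^p)`_N + ((g \Po 'X^p) * (Ex N - 1))`_N.
  rewrite mulrBr mulr1 coefB addrC subrK; apply: (@eq_uptoM _ N) => // i iN.
  rewrite !coef_comp_poly_Xn // FE coefD coefZ coefXn; case: ifP => // _.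
  rewrite ltn_eqF ?mulr0 ?addr0 //; case: (posnP i) => [->|i0]; first by rewrite div0n.
  by rewrite (leq_trans (ltn_Pdiv _ _)).
have gP : bd p%:R^-1 (g ^+ p - (g \Po 'X^p)).
  apply: poly_frobenius_congr => i iN; have := IH _ iN; split=> //.
  by apply: fermat_frac => //; exact: fps_exp_l_frac.
have ExP : bd p%:R^-1 (Ex N - 1).
  move=> i; rewrite coefB coef1 coef_poly; case: i => [|i] /=.
    by rewrite expr0 fact0 invr1 mulr1 subrr (absv0 absP).
  rewrite subr0; case: ifP => _; last by rewrite (absv0 absP).
  set x := _ / _; have : abs (x * (i.+1)`!%:R) = p%:R^-1 ^+ i.+1.
    by rewrite /x divfK ?natr_neq0 ?fact_gt0 // (absvX absP) abs_p.
  rewrite (absvM absP) abs_nat ?fact_gt0 // => /(canRL (mulfVK _)) -> .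
    rewrite natrX exprVn exprS invfM -mulrA ler_piMr //.
    rewrite mulrC ler_pdivrMr ?mul1r ?exprn_gt0 ?ltr0n // ler_weXn2l ?ler1n //.
    by rewrite -ltnS logn_fact_lt.
  by rewrite pnatr_eq0 -lt0n expn_gt0 p_gt0.
have gXP : bd 1 (g \Po 'X^p).
  move=> i; rewrite coef_comp_poly_Xn //; case: ifP => _; last by rewrite (absv0 absP).
  by rewrite coef_poly; case: ifP => h; [exact: IH|rewrite (absv0 absP)].
have : abs (p%:R * e N) <= p%:R^-1.
  have -> : p%:R * e N = ((g \Po 'X^p) * (Ex N - 1))`_N - (g ^+ p - (g \Po 'X^p))`_N.
    have := dwork_equation (leqnn N); rewrite h1 h2 => h.
    by rewrite coefB -(addKr (g ^+ p)`_N (p%:R * e N)) h; ring.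
  by apply: (absv_leB absP); [exact: bdM|exact: gP].
by rewrite (absvM absP) abs_p ger_pMr // invr_gt0 ltr0n.
Qed.

Lemma h_coefE x n : h_coef p x n = x ^+ n * e n.
Proof.
rewrite /e /h_coef /fps_exp !coef_sum mulr_sumr; apply: eq_bigr => i _.
rewrite !coefZ mulrCA; congr (_ * _).
suff H k m : (m <= n)%N ->
    ((\poly_(j < n.+1) (l_coef p j * x ^+ j)) ^+ k)`_m = x ^+ m * (P n ^+ k)`_m.
  exact: H.
elim: k m => [|k IH] m mn.
  by rewrite !expr0 coef1; case: eqP => [->|_]; rewrite ?mulr0 // expr0 mulr1.
rewrite !exprS !coefM mulr_sumr; apply: eq_bigr => j _; have := ltn_ord j.
rewrite ltnS => jm; rewrite IH ?(leq_trans (leq_subr _ _)) // !coef_poly.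
rewrite ltnS (leq_trans jm mn).
have -> : x ^+ m = x ^+ j * x ^+ (m - j) by rewrite -exprD subnKC.
ring.
Qed.

Lemma fps_exp_l1 : e 1 = 1.
Proof.
have := fps_exp_l_rec 1; rewrite big_ord_recr big_ord1 /= L0 mul0r add0r mul1r subnn fps_exp_l0.
by rewrite /L logn1 expn0 eqxx mulr1.
Qed.

End ArtinHasse.

(** * Sums over Z and the field H *)

Lemma bootstrap_le (R : realType) (T : Type) (F : T -> R) (M b d : R) :
  (forall x, 0 <= F x) -> (forall x, F x <= M) -> 0 <= d -> b < 1 ->
  (forall S, 0 <= S -> (forall x, F x <= S) -> forall x, F x <= Num.max d (b * S)) ->
  forall x, F x <= d.
Proof.
move=> F0 FM d0 b1 H x; rewrite leNgt; apply/negP => dF.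
have FS y : F y <= sup (range F).
  by apply: ub_le_sup; [exists M => _ [t _ <-]|exists y].
have S0 : 0 <= sup (range F) := le_trans (F0 x) (FS x).
have : sup (range F) <= Num.max d (b * sup (range F)).
  by apply: ge_sup; [exists (F x); exists x|move=> _ [t _ <-]; exact: H].
have dS : d < sup (range F) := lt_le_trans dF (FS x).
rewrite le_max leNgt dS /= -{1}[sup _]mul1r.
by rewrite ler_pM2r ?(le_lt_trans d0) // leNgt b1.
Qed.

Section SumsOverZ.
Context {R : realType} {K : fieldType} {abs : K -> R}.
Hypothesis absP : absolute_value abs.
Implicit Types (f a b : int -> K).

Let abs_ge0 := absv_ge0 absP.

Definition summable f := forall e : R, 0 < e -> exists N : nat,
  forall i : int, (N <= `|i|)%N -> abs (f i) < e.

Let psum f n := \sum_(i < n.*2.+1) f (i%:Z - n%:Z).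

Let psumS f n : psum f n.+1 = psum f n + f n.+1%:Z + f (- n.+1%:Z).
Proof.
rewrite /psum doubleS big_ord_recl big_ord_recr /= sub0r [LHS]addrC.
congr (_ + _); congr (_ + _).
  by apply: eq_bigr => i _; congr (f _); rewrite /bump /=; lia.
by congr (f _); rewrite /bump /=; lia.
Qed.

Let has_sumP f s : has_sum abs f s <-> forall e : R, 0 < e -> exists N : nat,
  forall n, (N <= n)%N -> abs (psum f n - s) < e.
Proof. exact: (cvg_abs0P abs_ge0 (fun n => psum f n - s)). Qed.

Lemma has_sum_le f s t M (N : nat) : has_sum abs f s ->
  (forall n, (N <= n)%N -> abs (psum f n - t) <= M) -> abs (s - t) <= M.
Proof.
move=> /has_sumP fs ft; rewrite leNgt; apply/negP => Mst.
have st0 : 0 < abs (s - t).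
  by apply: le_lt_trans Mst; apply: le_trans (ft N (leqnn N)).
have [N' hN'] := fs _ st0.
have h1 := hN' _ (leq_maxr N N'); rewrite [X in X < _](absv_distC absP) in h1.
have h2 := le_lt_trans (ft _ (leq_maxl N N')) Mst.
by have := absv_ltD absP h1 h2; rewrite subrKA ltxx.
Qed.

Lemma has_sum_bound f s M : has_sum abs f s -> (forall i, abs (f i) <= M) ->
  abs s <= M.
Proof.
move=> fs fM; rewrite -[s]subr0; apply: (has_sum_le (N := 0) fs) => n _.
by rewrite subr0; apply: (absv_sum_le absP) => //; exact: le_trans (fM 0).
Qed.

Let psum_term f n i : (`|i| <= n)%N ->
  exists o : 'I_n.*2.+1, (o%:Z - n%:Z = i) /\
  psum f n = f i + \sum_(j < n.*2.+1 | j != o) f (j%:Z - n%:Z).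
Proof.
move=> i_n; have h : (`|(i + n%:Z)%R| < n.*2.+1)%N by lia.
exists (Ordinal h) => /=; have E : (`|(i + n%:Z)%R|%N)%:Z - n%:Z = i by lia.
by split => //; rewrite /psum (bigD1 (Ordinal h)) //= E.
Qed.

Lemma has_sum_isolate f s i M : has_sum abs f s ->
  (forall j, j != i -> abs (f j) <= M) -> abs (s - f i) <= M.
Proof.
move=> fs fM; have M0 : 0 <= M.
  by apply: le_trans (abs_ge0 _) (fM (i + 1) _); apply/eqP; lia.
apply: (has_sum_le (N := `|i|%N) fs) => n hn.
have [k [k_i ->]] := psum_term f hn; rewrite addrC addKr.
apply: (absv_sum_le absP) => // j jk; apply: fM; apply: contraNneq jk => ji.
by apply/eqP/val_inj => /=; lia.
Qed.

Lemma has_sum_unique f s t : has_sum abs f s -> has_sum abs f t -> s = t.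
Proof.
move=> fs /has_sumP ft; apply/eqP; rewrite -subr_eq0; apply/negPn/negP.
move=> /(absv_gt0 absP) st0; have [N hN] := ft _ (divr_gt0 st0 (ltr0Sn _ 1)).
have := has_sum_le fs (fun n hn => ltW (hN n hn)).
by rewrite leNgt ltr_pdivrMr // ltr_pMr // ltr1n.
Qed.

Lemma zsum_eq f s : has_sum abs f s -> zsum abs f = s.
Proof.
move=> fs; apply: (has_sum_unique _ fs).
by rewrite /zsum; apply: (xgetPex 0 (P := [set s | has_sum abs f s])); exists s.
Qed.

Lemma has_sumB f g s t : has_sum abs f s -> has_sum abs g t ->
  has_sum abs (fun i => f i - g i) (s - t).
Proof.
move=> /has_sumP fs /has_sumP gt; apply/has_sumP => e e0.
have [N1 h1] := fs e e0; have [N2 h2] := gt e e0.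
exists (maxn N1 N2) => n; rewrite geq_max => /andP[n1 n2].
rewrite /psum sumrB -/(psum f n) -/(psum g n).
rewrite (_ : _ - (s - t) = (psum f n - s) - (psum g n - t)); last by ring.
by apply: (absv_ltB absP); [exact: h1|exact: h2].
Qed.

Lemma has_sum_single f i : (forall j, j != i -> f j = 0) -> has_sum abs f (f i).
Proof.
move=> f0; apply/has_sumP => e e0; exists `|i|%N => n hn.
have [k [k_i ->]] := psum_term f hn; rewrite addrC addKr big1 ?(absv0 absP) //.
move=> j jk; apply: f0; apply: contraNneq jk => ji.
by apply/eqP/val_inj => /=; lia.
Qed.

Lemma has_sum_nonneg f n : (forall i : int, i < 0 -> f i = 0) ->
  (forall i : int, n%:Z < i -> f i = 0) -> has_sum abs f (\sum_(i < n.+1) f i%:Z).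
Proof.
move=> fneg fbig; apply/has_sumP => e e0; exists n => m nm.
suff -> : psum f m = \sum_(i < n.+1) f i%:Z by rewrite subrr (absv0 absP).
have psumE k : psum f k = \sum_(i < k.+1) f i%:Z.
  elim: k => [|k IH]; first by rewrite /psum double0 !big_ord1 subr0.
  by rewrite psumS IH [RHS]big_ord_recr /= [f (- _)]fneg ?addr0 //; lia.
elim: m nm => [|m IH]; first by rewrite leqn0 psumE => /eqP ->.
rewrite leq_eqVlt => /orP[/eqP ->|nm]; first by rewrite psumE.
by rewrite psumS (fbig m.+1%:Z) ?fneg // ?addr0 ?IH // ltz_nat.
Qed.

Hypothesis K_complete : abs_complete abs.

Lemma has_sum_zsum f : summable f -> has_sum abs f (zsum abs f).
Proof.
move=> fs; suff [l lP] : exists l, has_sum abs f l by rewrite (zsum_eq lP).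
have [|l lP] := @K_complete (psum f); last by exists l.
move=> e e0; have [N hN] := fs e e0; exists N.
suff H n : (N <= n)%N -> abs (psum f n - psum f N) < e.
  move=> m n hm hn; have -> : psum f m - psum f n = (psum f m - psum f N) - (psum f n - psum f N).
    by rewrite opprB addrA subrK.
  by apply: (absv_ltB absP); exact: H.
elim: n => [|n IH]; first by rewrite leqn0 => /eqP ->; rewrite subrr (absv0 absP).
rewrite leq_eqVlt => /orP[/eqP ->|Nn]; first by rewrite subrr (absv0 absP).
have -> : psum f n.+1 - psum f N = psum f n - psum f N + (f n.+1%:Z + f (- n.+1%:Z)).
  by rewrite psumS; ring.
apply: (absv_ltD absP); first exact: IH.
by apply: (absv_ltD absP); apply: hN; lia.
Qed.

Lemma has_sum_hmul a b n : summable (fun i => a i * b (n - i)) ->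
  has_sum abs (fun i => a i * b (n - i)) (hmul abs a b n).
Proof. exact: has_sum_zsum. Qed.

End SumsOverZ.

Arguments summable {R K} abs f.

Section HField.
Context {R : realType} {K : fieldType} {abs : K -> R}.
Hypothesis absP : absolute_value abs.
Implicit Types (a b h : int -> K).
Let abs_ge0 := absv_ge0 absP.

Lemma Hfield_bounded h : Hfield abs h ->
  exists2 M : R, 0 <= M & forall i, abs (h i) <= M.
Proof.
move=> [[M hM] _]; exists M.
  by apply: le_trans (abs_ge0 _) (hM _ _); exists 0.
by move=> i; apply: hM; exists i.
Qed.

Lemma hnorm_ge h i : has_ubound (range (fun i => abs (h i))) ->
  abs (h i) <= hnorm abs h.
Proof. by move=> hb; apply: ub_le_sup => //; exists i. Qed.

Lemma hnorm_le h M : (forall i, abs (h i) <= M) -> hnorm abs h <= M.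
Proof.
move=> hM; apply: ge_sup; first by exists (abs (h 0)); exists 0.
by move=> _ [i _ <-].
Qed.

Lemma HfieldB_le a b e i : Hfield abs a -> Hfield abs b ->
  hnorm abs (a - b) < e -> abs (a i - b i) <= e.
Proof.
move=> /Hfield_bounded[M M0 aM] /Hfield_bounded[N N0 bN] abe.
apply: le_trans (ltW abe); apply: (@hnorm_ge (a - b)).
exists (Num.max M N) => _ [j _ <-]; apply: (absv_leB absP); rewrite le_max.
  by rewrite aM.
by rewrite bN orbT.
Qed.

Lemma Hfield_decay h (e : R) : Hfield abs h -> 0 < e ->
  exists N : nat, forall n, (N <= n)%N -> abs (h n%:Z) < e.
Proof. by move=> [_ /(cvg_abs0P abs_ge0)]; apply. Qed.

Lemma summable_mul a b n M : Hfield abs a -> (forall i, abs (b i) <= M) ->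
  (forall i : int, i < 0 -> a i = 0) \/ (forall i : int, 0 < i -> b i = 0) ->
  summable abs (fun i => a i * b (n - i)).
Proof.
move=> aH bM ab e e0; have M0 : 0 <= M := le_trans (abs_ge0 _) (bM 0).
have [|N hN] := @Hfield_decay a (e / (M + 1)) aH.
  by rewrite divr_gt0 // ltr_wpDl.
exists (maxn N `|n|.+1); move=> i; rewrite geq_max => /andP[iN i_n].
have [i0|i0] := ltP i 0.
  suff -> : a i * b (n - i) = 0 by rewrite (absv0 absP).
  case: ab => [->|->]; rewrite ?mul0r ?mulr0 //; lia.
have iE : i = `|i|%N%:Z by lia.
rewrite (absvM absP); apply: le_lt_trans (_ : abs (a i) * (M + 1) < e).
  by rewrite ler_wpM2l // (le_trans (bM _)) // lerDl.
by rewrite -ltr_pdivlMr ?ltr_wpDl // iE hN.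
Qed.

Lemma Gamma_at_le rho h : Gamma_at abs rho h -> forall i, abs (h i) <= 1.
Proof. by move=> [[[hb _] _] <- _ _] i; exact: hnorm_ge. Qed.

End HField.

(** * Elements of Gamma close to A *)

Section Core.
Context {R : realType} {K : fieldType} {abs : K -> R}.
Hypotheses (absP : absolute_value abs) (K_complete : abs_complete abs).
Let abs_ge0 := absv_ge0 absP.

Section StrictlyIntegral.
Variable A : set (int -> K).
Hypothesis A_const : A `&` laurent_nonpos = [set c \*o one_series | c in [set: K]].
Hypothesis A_int : strictly_integral abs A.

Lemma degrees0 : degrees A 0%N.
Proof.
have [h _] : (A `&` laurent_nonpos) one_series.
  by rewrite A_const; exists 1 => //; apply/funext => n; rewrite /= mul1r.
exists one_series => //; split; first by rewrite /one_series eqxx oner_neq0.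
by move=> m m0; rewrite /one_series gt_eqF.
Qed.

(* By triangularity, the coordinates of a in the standard basis are its
   coefficients at the degrees of A. *)
Lemma coef_le_degrees a (S : R) : A a -> 0 <= S ->
  (forall m, degrees A m -> (0 < m)%N -> abs (a m%:Z) <= S) ->
  forall k, k != 0 -> abs (a k) <= S.
Proof.
have [v [s [s_mono s_deg [vA v_span _] v_deg v_zero]] v_int] := A_int.
have s0 : s 0%N = 0%N.
  have := degrees0; rewrite -s_deg => -[i _ si].
  case: i si => // i si; have := s_mono 0%N i.+1 isT.
  by rewrite si ltn0.
have v0 k : k != 0 -> v 0%N k = 0.
  move=> k0; have : (A `&` laurent_nonpos) (v 0%N).
    split; first exact: vA.
    by move=> m m0; have [[_ h] _] := v_deg 0%N; apply: h; rewrite s0.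
  by rewrite A_const => -[c _ <-]; rewrite /= /one_series (negPf k0) mulr0.
move=> Aa S0 aS k k0; have [n [c aE]] := v_span a Aa.
have aEk j : a j = \sum_(i < n) c i * v i j.
  by rewrite aE fct_sumE.
rewrite aEk; apply: (absv_sum_le absP) => // i _.
case: (posnP i) => [->|i0]; first by rewrite v0 // mulr0 (absv0 absP).
suff ci : abs (c i) <= S.
  by rewrite -[S]mulr1; apply: (absvM_le absP).
suff -> : c i = a (s i)%:Z.
  apply: aS; first by rewrite -s_deg; exists i.
  by rewrite -s0; exact: s_mono.
rewrite aEk (bigD1 i) //= big1 ?addr0; first by case: (v_deg i) => _ ->; rewrite mulr1.
move=> j ji; have [lt|gt|/val_inj ji'] := ltngtP j i; last by rewrite ji' eqxx in ji.
  by case: (v_deg j) => -[_ h] _; rewrite h ?mulr0 // ltz_nat s_mono.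
by rewrite v_zero ?mulr0.
Qed.

(* With w = alpha c for some alpha in A close to u, the coefficients of
   w - c_0 alpha of positive index are dominated by d times the negative
   coefficients of c, hence D is close to an element of A in positive degrees,
   and D vanishes at the degrees of A. *)
Lemma gap_coef_lt (h h' u c D : int -> K) (rho r d : R) :
  h = hmul abs h' (hmul abs u c) ->
  Hfield abs h' -> (forall i : int, i < 0 -> h' i = 0) -> h' 0 = 1 ->
  (forall i, i != 0 -> abs (h' i) <= r) -> 0 <= r -> r < 1 ->
  closure_H abs A u -> 0 <= rho -> rho < 1 -> Gamma_at abs rho u ->
  Gamma_at abs 0 c -> 0 < d -> d < 1 ->
  (forall n, abs (D n) <= d) ->
  (forall n, abs (h n - h' n - D n) <= r * d) ->
  (forall m, degrees A m -> D m%:Z = 0) ->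
  exists2 t : R, t < d & forall n : nat, (0 < n)%N -> abs (D n%:Z) <= t.
Proof.
move=> hE h'H h'neg h'0 h'r r0 r1 [uH uA] rho0 rho1 uG cG d0 d1 Dd hD Ddeg.
have u1 := Gamma_at_le uG; have c1 := Gamma_at_le cG.
have [_ _ u0 upos] := uG; have [_ _ c0 cpos] := cG.
have cP (i : int) : 0 < i -> c i = 0.
  case: i => // -[//|i] _; apply/(absv_eq0 absP)/eqP; rewrite eq_le abs_ge0 andbT.
  by have := cpos i.+1 isT; rewrite expr0n.
have rd : r * d < d by rewrite gtr_pMl.
set y := hmul abs u c in hE.
have y_sum n : has_sum abs (fun i => u i * c (n - i)) (y n).
  by apply: has_sum_hmul => //; apply: (summable_mul absP _ uH c1); right.
have y1 n : abs (y n) <= 1.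
  by apply: (has_sum_bound absP (y_sum n)) => i; rewrite -[1]mulr1; apply: absvM_le.
have h_sum n : has_sum abs (fun i => h' i * y (n - i)) (h n).
  by rewrite hE; apply: has_sum_hmul => //; apply: (summable_mul absP _ h'H y1); left.
pose z n := y n - one_series n.
have z_sum n : has_sum abs (fun i => h' i * z (n - i)) (h n - h' n).
  have h'_sum : has_sum abs (fun i => h' i * one_series (n - i)) (h' n).
    have := @has_sum_single _ _ _ absP (fun i => h' i * one_series (n - i)) n.
    rewrite subrr /one_series eqxx mulr1; apply=> j jn.
    by rewrite subr_eq0 eq_sym (negPf jn) mulr0.
  rewrite (_ : (fun _ => _) = fun i => h' i * y (n - i) - h' i * one_series (n - i)).
    exact: has_sumB.
  by apply/funext => i; rewrite /z mulrBr.
have z_near S : 0 <= S -> (forall n, abs (z n) <= S) ->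
    forall n, abs (h n - h' n - z n) <= r * S.
  move=> S0 zS n; have := has_sum_isolate absP (z_sum n) (i := 0) (M := r * S).
  rewrite h'0 mul1r subr0; apply=> j j0; apply: (absvM_le absP) => //; exact: h'r.
have hd n : abs (h n - h' n) <= d.
  rewrite -[_ - _](subrK (D n)); apply: (absv_leD absP) => //.
  by rewrite (le_trans (hD n)) // ltW.
have zd : forall n, abs (z n) <= d.
  apply: (@bootstrap_le _ _ _ 1 r) => //; last 1 first.
  - move=> S S0 zS n; rewrite -(subKr (h n - h' n) (z n)).
    apply: (absv_leB absP); rewrite le_max ?hd // [X in _ || X]z_near ?orbT //.
  - move=> n; apply: (absv_leB absP) => //; rewrite /one_series.
    by case: eqP => _; rewrite ?(absv0 absP) ?(absv1 absP).
  - exact: ltW.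
have zD n : abs (z n - D n) <= r * d.
  have -> : z n - D n = (h n - h' n - D n) - (h n - h' n - z n) by ring.
  by apply: (absv_leB absP) => //; apply: z_near => //; exact: ltW.
pose e := Num.min d 1 / 2.
have [e0 ed e1] : [/\ 0 < e, e < d & e < 1].
  have m0 : 0 < Num.min d 1 by rewrite lt_min d0 ltr01.
  have md : Num.min d 1 <= d by rewrite ge_min lexx.
  have m1 : Num.min d 1 <= 1 by rewrite ge_min lexx orbT.
  by rewrite /e; move: (Num.min d 1) m0 md m1 => m *; split; lra.
have [a [Aa aH ua]] := uA e e0.
have {ua} uae n : abs (u n - a n) <= e by exact: (HfieldB_le absP).
set w := hmul abs a c.
have [M M0 aM] := Hfield_bounded absP aH.
have w_sum n : has_sum abs (fun i => a i * c (n - i)) (w n).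
  by apply: has_sum_hmul => //; apply: (summable_mul absP _ aH c1); right.
have yw n : abs (y n - w n) <= e.
  apply: (has_sum_bound absP (has_sumB absP (y_sum n) (w_sum n))) => i.
  by rewrite -mulrBl -[e]mulr1; apply: (absvM_le absP).
set tau := Num.max rho e.
have tau1 : tau < 1 by rewrite gt_max rho1.
have a_small k : k != 0 -> abs (a k) <= tau.
  apply: coef_le_degrees => //; first by rewrite le_max rho0.
  move=> m _ m0; rewrite -(subKr (u m%:Z) (a m%:Z)); apply: (absv_leB absP).
    rewrite le_max (le_trans (upos m m0)) // -{2}[rho]expr1.
    by rewrite ler_wiXn2l // ltW.
  by rewrite le_max uae orbT.
have a0 : abs (a 0) = 1.
  rewrite -u0; apply: (absv_isosceles absP).
  by rewrite (absv_distC absP) u0 (le_lt_trans (uae 0)).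
set b := Num.max tau d.
have [b0 b1] : 0 <= b /\ b < 1.
  by rewrite le_max (ltW d0) orbT gt_max tau1.
have c_small n : n < 0 -> abs (c n) <= b.
  move=> n0; have wn : abs (w n) <= b.
    have -> : w n = z n - (y n - w n) by rewrite /z /one_series lt_eqF // mulr0n; ring.
    by apply: (absv_leB absP); rewrite !le_max ?zd ?yw ?orbT.
  have wac : abs (w n - a 0 * c n) <= b.
    have := has_sum_isolate absP (w_sum n) (i := 0) (M := b); rewrite subr0; apply=> j j0.
    rewrite -[b]mulr1; apply: (absvM_le absP) => //.
    by rewrite le_max a_small.
  rewrite -[abs (c n)]mul1r -a0 -(absvM absP) -(subKr (w n) (a 0 * c n)).
  exact: (absv_leB absP).
have w_near S (n : int) : (forall i : int, 0 < i -> abs (a i) <= S) -> 0 < n ->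
    abs (w n - c 0 * a n) <= S * b.
  move=> aS n0; have S0 : 0 <= S := le_trans (abs_ge0 _) (aS _ n0).
  have := has_sum_isolate absP (w_sum n) (i := n) (M := S * b).
  rewrite subrr [a n * _]mulrC; apply=> j jn.
  have [jn'|nj|nj] := ltgtP j n; last by rewrite nj eqxx in jn.
    by rewrite cP ?subr_gt0 // mulr0 (absv0 absP) mulr_ge0.
  apply: (absvM_le absP); last by rewrite c_small // subr_lt0.
  exact: aS (lt_trans n0 nj).
pose t1 := Num.max (r * d) e.
have t1d : t1 < d by rewrite gt_max rd ed.
have wD n : 0 < n -> abs (w n - D n) <= t1.
  move=> n0; have -> : w n - D n = (z n - D n) - (y n - w n).
    by rewrite /z /one_series gt_eqF // mulr0n; ring.
  by apply: (absv_leB absP); rewrite le_max ?zD ?yw ?orbT.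
have a_d : forall i : int, 0 < i -> abs (a i) <= d.
  have H := @bootstrap_le R nat (fun i => abs (a i.+1%:Z)) tau b d.
  case=> // -[//|i] _; apply: H => //; last 1 first.
  - move=> S S0 aS n; rewrite -[abs _]mul1r -c0 -(absvM absP).
    rewrite -(subKr (w n.+1) (c 0 * _)); apply: (absv_leB absP).
      rewrite -(subrK (D n.+1) (w n.+1)) le_max; apply/orP; left.
      by apply: (absv_leD absP) => //; rewrite (le_trans (wD _ _)) // ltW.
    rewrite le_max [b * S]mulrC [X in _ || X]w_near ?orbT //.
    by case=> // -[//|k] _; exact: aS.
  - by move=> k; exact: a_small.
  - exact: ltW.
pose t := Num.max t1 (d * b).
have td : t < d by rewrite gt_max t1d gtr_pMr.
have t0 : 0 <= t by rewrite le_max mulr_ge0 ?orbT // ltW.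
exists t => // n n0.
have Dca k : 0 < k -> abs (D k - c 0 * a k) <= t.
  move=> k0; have -> : D k - c 0 * a k = (w k - c 0 * a k) - (w k - D k) by ring.
  by apply: (absv_leB absP); rewrite le_max ?wD ?w_near ?orbT.
have ca k : abs (c 0 * a k) = abs (a k) by rewrite (absvM absP) c0 mul1r.
have a_t : abs (a n%:Z) <= t.
  apply: coef_le_degrees => //; last by rewrite -lt0n.
  move=> m mA m0; have := Dca m%:Z; rewrite Ddeg // sub0r (absvN absP) ca.
  by apply; rewrite ltz_nat.
rewrite -(subrK (c 0 * a n%:Z) (D n%:Z)); apply: (absv_leD absP).
  by apply: Dca; rewrite ltz_nat.
by rewrite ca.
Qed.

End StrictlyIntegral.
End Core.

(** * The power series h_mu *)

Lemma exprn_ge_lt1 (R : realType) (x : R) n : 0 <= x -> x < 1 -> (0 < n)%N ->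
  exists r : R, [/\ 0 <= r, r < 1 & x <= r ^+ n].
Proof.
move=> x0 x1 n0; have n1 : 1 <= n%:R :> R by rewrite ler1n.
pose y := (1 - x) / n%:R.
have ny : y * n%:R = 1 - x by rewrite divfK // pnatr_eq0 -lt0n.
have y0 : 0 < y by rewrite divr_gt0 ?ltr0n // subr_gt0.
have y1 : y <= 1 by nra.
exists (1 - y); split; [lra|lra|].
suff bernoulli k : 1 - y * k%:R <= (1 - y) ^+ k.
  by have := bernoulli n; rewrite ny; lra.
elim: k => [|k IH]; first by rewrite mulr0 subr0 expr0.
rewrite exprS -natr1; have k0 : 0 <= k%:R :> R by [].
have : (1 - y) * (1 - y * k%:R) <= (1 - y) * (1 - y) ^+ k by rewrite ler_wpM2l //; lra.
by apply: le_trans; nra.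
Qed.

Section PowerSeries.
Context {R : realType} {K : fieldType} {abs : K -> R}.
Hypothesis absP : absolute_value abs.
Let abs_ge0 := absv_ge0 absP.
Implicit Types (a b D E : nat -> K).

Definition power_series a : int -> K := fun n => if n is Posz m then a m else 0.

Definition cauchy_prod a b : nat -> K :=
  fun n => \sum_(i < n.+1) a i * b (n - i)%N.

Definition series1 : nat -> K := fun n => (n == 0%N)%:R.

Lemma power_series1 : power_series series1 = one_series.
Proof. by apply/funext => -[n|n]. Qed.

Lemma hmul_power_series a b :
  power_series (cauchy_prod a b) = hmul abs (power_series a) (power_series b).
Proof.
apply/funext => n; apply/esym/(zsum_eq absP).
case: n => n /=.
  rewrite (_ : cauchy_prod a b n = \sum_(i < n.+1)
    power_series a i%:Z * power_series b (n%:Z - i%:Z)).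
    apply: (has_sum_nonneg absP) => -[i|i] // ni; first by rewrite /= mul0r.
    have : n%:Z - i%:Z < 0 by lia.
    by case: (n%:Z - i%:Z) => // k _; rewrite mulr0.
  by apply: eq_bigr => i _; rewrite subzn // -ltnS.
have := @has_sum_single _ _ _ absP (fun i => power_series a i * power_series b (Negz n - i)) 0.
rewrite subr0 /= mulr0; apply=> -[i|i] _ /=; last by rewrite mul0r.
have : Negz n - i%:Z < 0 by lia.
by case: (Negz n - i%:Z) => // k _; rewrite mulr0.
Qed.

Lemma sum_series1l a n : \sum_(i < n.+1) series1 i * a (n - i)%N = a n.
Proof.
rewrite big_ord_recl /series1 /= subn0 mul1r big1 ?addr0 // => i _.
by rewrite /= mul0r.
Qed.

Lemma sum_series1r a n : \sum_(i < n.+1) a i * series1 (n - i)%N = a n.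
Proof.
rewrite big_ord_recr /series1 /= subnn mulr1 big1 ?add0r // => i _.
by rewrite subn_eq0 leqNgt ltn_ord /= mulr0.
Qed.

Variable rho : R.
Hypotheses (rho0 : 0 <= rho) (rho1 : rho < 1).

Definition geom_bounded a := a 0%N = 1 /\ forall n, abs (a n) <= rho ^+ n.

Let rho_le n : (0 < n)%N -> rho ^+ n <= rho.
Proof. by move=> n0; rewrite -{2}[rho]expr1 ler_wiXn2l // ltW. Qed.

Let rho_le1 n : rho ^+ n <= 1.
Proof. by rewrite exprn_ile1 // ltW. Qed.

Let geom_le1 a n : geom_bounded a -> abs (a n) <= 1.
Proof. by move=> [_ h]; exact: le_trans (h n) (rho_le1 n). Qed.

Let geom_near1 a n : geom_bounded a -> abs (a n - series1 n) <= rho.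
Proof.
move=> [a0 h]; rewrite /series1; case: n => [|n].
  by rewrite a0 subrr (absv0 absP).
by rewrite subr0 (le_trans (h _)) // rho_le.
Qed.

Lemma geom_bounded1 : geom_bounded series1.
Proof.
split=> // n; rewrite /series1; case: n => [|n]; first by rewrite (absv1 absP).
by rewrite (absv0 absP) exprn_ge0.
Qed.

Lemma geom_boundedM a b : geom_bounded a -> geom_bounded b ->
  geom_bounded (cauchy_prod a b).
Proof.
move=> [a0 ha] [b0 hb]; split; first by rewrite /cauchy_prod big_ord1 a0 b0 mulr1.
move=> n; apply: (absv_sum_le absP); first exact: exprn_ge0.
move=> i _; have i_n : (i <= n)%N by rewrite -ltnS.
have -> : rho ^+ n = rho ^+ i * rho ^+ (n - i) by rewrite -exprD subnKC.
exact: (absvM_le absP).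
Qed.

Section Perturbation.
Variable d : R.

Definition perturbed a b D := [/\ geom_bounded a, geom_bounded b,
  forall n, abs (D n) <= d & forall n, abs (a n - b n - D n) <= rho * d].

Lemma perturbedM a a' b b' D E : perturbed a a' D -> perturbed b b' E ->
  perturbed (cauchy_prod a b) (cauchy_prod a' b') (D + E).
Proof.
move=> [ga ga' Dd aD] [gb gb' Ed bE].
have d0 : 0 <= d := le_trans (abs_ge0 _) (Dd 0%N).
split; [exact: geom_boundedM|exact: geom_boundedM| |].
  by move=> n; exact: (absv_leD absP).
move=> n; rewrite /cauchy_prod -sumrB.
have -> : (D + E) n = \sum_(i < n.+1) (D i * series1 (n - i)%N + series1 i * E (n - i)%N).
  by rewrite big_split /= sum_series1l sum_series1r.
rewrite -sumrB; apply: (absv_sum_le absP); first exact: mulr_ge0.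
move=> i _; move: (n - i)%N => j.
have -> : a i * b j - a' i * b' j - (D i * series1 j + series1 i * E j) =
    a i * (b j - b' j - E j) + (a i - a' i - D i) * b' j +
    ((a i - series1 i) * E j + D i * (b' j - series1 j)) by ring.
apply: (absv_leD absP); apply: (absv_leD absP).
- by rewrite -[rho * d]mul1r; apply: (absvM_le absP) => //; exact: geom_le1.
- by rewrite -[rho * d]mulr1; apply: (absvM_le absP) => //; exact: geom_le1.
- by apply: (absvM_le absP) => //; exact: geom_near1.
- by rewrite mulrC; apply: (absvM_le absP) => //; exact: geom_near1.
Qed.

End Perturbation.

Fixpoint inv_coefs a n : seq K := if n is k.+1 then
    rcons (inv_coefs a k)
      (series1 k - \sum_(i < k) a (k - i)%N * nth 0 (inv_coefs a k) i)
  else [::].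

Lemma geom_bounded_inv a : geom_bounded a ->
  exists2 b, geom_bounded b & cauchy_prod a b = series1.
Proof.
move=> [a0 ha]; pose b n := nth 0 (inv_coefs a n.+1) n.
have size_inv n : size (inv_coefs a n) = n.
  by elim: n => //= n IH; rewrite size_rcons IH.
have nth_inv n i : (i < n)%N -> nth 0 (inv_coefs a n) i = b i.
  elim: n => // n IH; rewrite ltnS leq_eqVlt => /orP[/eqP -> //|i_n].
  by rewrite /= nth_rcons size_inv i_n IH.
have bE n : b n = series1 n - \sum_(i < n) a (n - i)%N * b i.
  rewrite /b /= nth_rcons size_inv ltnn eqxx; congr (_ - _).
  by apply: eq_bigr => i _; rewrite nth_inv.
exists b; first split; first by rewrite bE big_ord0 subr0.
  elim/ltn_ind => n IH; rewrite bE; apply: (absv_leB absP).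
    by case: geom_bounded1.
  apply: (absv_sum_le absP); first exact: exprn_ge0.
  move=> i _; have -> : rho ^+ n = rho ^+ (n - i) * rho ^+ i.
    by rewrite -exprD subnK // ltnW.
  by apply: (absvM_le absP) => //; exact: IH.
apply/funext => n; rewrite /cauchy_prod (reindex_inj rev_ord_inj) /=.
rewrite big_ord_recr /= subSS subnn subn0 a0 mul1r [b n]bE addrC.
apply/eqP; rewrite -addrA -subr_eq0 addrAC subrr add0r addrC subr_eq0; apply/eqP.
apply: eq_bigr => i _; rewrite subSS subKn //; exact: ltnW.
Qed.

Lemma power_series_Hfield a : geom_bounded a -> Hfield abs (power_series a).
Proof.
move=> ga; split.
  exists 1 => _ [[n|n] _ <-] /=; first exact: geom_le1.
  by rewrite (absv0 absP).
apply/(cvg_abs0P abs_ge0) => e e0.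
have /cvgr0Pnorm_lt/(_ e e0)[N _ hN] : (fun n => rho ^+ n) @ \oo --> (0 : R).
  by apply: cvg_expr; rewrite ger0_norm.
exists N => n Nn; have := hN n Nn; rewrite /= ger0_norm ?exprn_ge0 //.
by apply: le_lt_trans; case: ga => _; apply.
Qed.

Lemma power_series_Gamma_at a : geom_bounded a -> Gamma_at abs rho (power_series a).
Proof.
move=> ga; have aH := power_series_Hfield ga.
have a1 : abs (power_series a 0) = 1 by case: ga => /= -> _; exact: absv1.
split => //; last by move=> i _; case: ga => _; apply.
- have [b gb ab] := geom_bounded_inv ga.
  split=> //; exists (power_series b); first exact: power_series_Hfield.
  by rewrite -hmul_power_series ab power_series1.
- apply/eqP; rewrite eq_le; apply/andP; split.
    apply: hnorm_le => -[n|n] /=; first exact: geom_le1.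
    by rewrite (absv0 absP).
  by rewrite -{1}a1; apply: hnorm_ge; case: aH.
Qed.

End PowerSeries.

Section HMu.
Context {R : realType} {K : fieldType} {abs : K -> R} (p : nat).
Hypothesis absP : absolute_value abs.
Hypothesis p_prime : prime p.
Hypothesis abs_nat : forall n, (0 < n)%N -> abs n%:R = (p ^ logn p n)%:R^-1.
Variables (g : nat) (mu : 'I_g -> nat).
Hypothesis mu_gt0 : forall i, (0 < mu i)%N.
Implicit Types pi : 'I_g -> K.

Let factor d (x : K) : nat -> K :=
  fun m => if (d %| m)%N then h_coef p x (m %/ d) else 0.

Let h_series pi : nat -> K :=
  \big[cauchy_prod/series1]_(i < g) factor (mu i) (pi i).

Lemma h_mu_power_series pi : h_mu abs p mu pi = power_series (h_series pi).
Proof.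
rewrite /h_series (big_morph _ (hmul_power_series absP) power_series1).
apply: eq_bigr => i _; apply/funext => -[n|n] //.
Qed.

Let factor_geom (rho : R) d (x : K) : 0 <= rho -> (0 < d)%N ->
  abs x <= rho ^+ d -> geom_bounded (abs := abs) rho (factor d x).
Proof.
move=> rho0 d0 xr; split.
  by rewrite /factor dvdn0 div0n h_coefE // fps_exp_l0 mulr1.
move=> n; rewrite /factor; case: ifP => dn; last by rewrite (absv0 absP) exprn_ge0.
have -> : rho ^+ n = rho ^+ d ^+ (n %/ d) * 1 by rewrite mulr1 -exprM mulnC divnK.
rewrite h_coefE.
apply: (absvM_le absP); last exact: (fps_exp_l_integral absP p_prime abs_nat).
by rewrite (absvX absP) lerXn2r // nnegrE ?exprn_ge0 // (absv_ge0 absP).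
Qed.

Let factor_perturbed (rho del : R) d (x y : K) : 0 <= rho -> rho < 1 -> (0 < d)%N ->
  abs x <= rho ^+ d -> abs y <= rho ^+ d -> abs (x - y) <= del ->
  perturbed (abs := abs) rho del (factor d x) (factor d y)
    (fun n => if n == d then x - y else 0).
Proof.
move=> rho0 rho1 d0 xr yr xy; have del0 := le_trans (absv_ge0 absP _) xy.
split; [exact: factor_geom|exact: factor_geom| |].
  by move=> n; case: eqP => _ //; rewrite (absv0 absP).
have rd : 0 <= rho * del by rewrite mulr_ge0.
move=> n; rewrite /factor; case: ifP => dn; last first.
  rewrite subrr sub0r (absvN absP); case: eqP => [nd|_]; last by rewrite (absv0 absP).
  by rewrite nd dvdnn in dn.
case/dvdnP: dn => m ->; rewrite mulnK // !h_coefE.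
case: m => [|[|m]].
- rewrite mul0n eq_sym gtn_eqF // !expr0 subrr subr0.
  by rewrite (absv0 absP).
- by rewrite mul1n eqxx (fps_exp_l1 absP p_prime abs_nat) !expr1 !mulr1 subrr (absv0 absP).
rewrite gtn_eqF ?subr0; last by rewrite -{1}[d]mul1n ltn_pmul2r.
rewrite -mulrBl subrXX mulrC mulrA -[rho * del]mul1r -mulrA [rho * _]mulrC.
have le_rho z k : abs z <= rho ^+ d -> abs (z ^+ k) <= rho ^+ k.
  move=> zr; rewrite (absvX absP) lerXn2r ?nnegrE ?(absv_ge0 absP) //.
  by rewrite (le_trans zr) // -{2}[rho]expr1 ler_wiXn2l // ltW.
apply: (absvM_le absP); first exact: (fps_exp_l_integral absP p_prime abs_nat).
apply: (absvM_le absP) => //; apply: (absv_sum_le absP) => // i _.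
have im : (i <= m.+1)%N by rewrite -ltnS.
apply: le_trans (_ : rho ^+ m.+1 <= _); last first.
  by rewrite -{2}[rho]expr1 ler_wiXn2l // ltW.
have -> : rho ^+ m.+1 = rho ^+ (m.+1 - i) * rho ^+ i by rewrite -exprD subnK.
by apply: (absvM_le absP); exact: le_rho.
Qed.

Lemma h_mu_perturbed (rho del : R) pi pi' : 0 <= rho -> rho < 1 -> 0 <= del ->
  (forall i, abs (pi i) <= rho ^+ mu i) -> (forall i, abs (pi' i) <= rho ^+ mu i) ->
  (forall i, abs (pi i - pi' i) <= del) ->
  perturbed (abs := abs) rho del (h_series pi) (h_series pi')
    (\sum_(i < g) (fun n => if n == mu i then pi i - pi' i else 0)).
Proof.
move=> rho0 rho1 del0 hpi hpi' hd.
rewrite /h_series; apply: (big_ind3 (perturbed (abs := abs) rho del)).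
- split; [exact: geom_bounded1|exact: geom_bounded1| |].
    by move=> n; rewrite (absv0 absP).
  by move=> n; rewrite subrr subr0 (absv0 absP) mulr_ge0.
- by move=> a a' D b b' E; exact: perturbedM.
- by move=> i _; exact: factor_perturbed.
Qed.

Lemma exists_radius (F : 'I_g -> R) : (forall i, 0 <= F i < 1) ->
  exists rho : R, [/\ 0 <= rho, rho < 1 & forall i, F i <= rho ^+ mu i].
Proof.
move=> F01; have H i : exists r, [/\ 0 <= r, r < 1 & F i <= r ^+ mu i].
  by have /andP[? ?] := F01 i; exact: exprn_ge_lt1.
have [r hr] := choice H.
exists (\big[Num.max/0]_(i < g) r i); split; first exact: bigmax_ge_id.
  by apply: bigmax_lt => // i _; case: (hr i).
move=> i; have [r0 _ h] := hr i; rewrite (le_trans h) //.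
rewrite lerXn2r ?nnegrE ?bigmax_ge_id //; exact: le_bigmax.
Qed.

End HMu.

Lemma padic_ext_abs_nat (R : realType) (p : nat) (Qp : fieldType)
    (absQ : Qp -> R) (K : fieldExtType Qp) (abs : K -> R) :
  is_padic_field p absQ -> extends_abs absQ abs ->
  forall n, (0 < n)%N -> abs n%:R = (p ^ logn p n)%:R^-1.
Proof.
move=> [_ absQ_rat _ _] [_ abs_ext] n n0.
have -> : n%:R = (n%:R : Qp)%:A :> K by rewrite scaler_nat.
rewrite abs_ext -(ratr_nat Qp n) absQ_rat /padic_abs pnatr_eq0 gtn_eqF //.
have -> : n%:R = n%:Z%:~R :> rat by rewrite pmulrn.
by rewrite numq_int denq_int /= logn1 expr0 div1r natrX.
Qed.

Section GammaSubgroup.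
Context {R : realType} {K : fieldType} {abs : K -> R}.
Hypothesis absP : absolute_value abs.

Lemma hmul_one_power_series (a : nat -> K) :
  hmul abs (power_series a) one_series = power_series a.
Proof.
rewrite -power_series1 -(hmul_power_series absP); congr power_series.
by apply/funext => n; exact: sum_series1r.
Qed.

Lemma one_Gamma_at (rho : R) : 0 <= rho -> rho < 1 -> Gamma_at abs rho one_series.
Proof.
move=> rho0 rho1; rewrite -power_series1.
by apply: power_series_Gamma_at => //; exact: geom_bounded1.
Qed.

Lemma one_Gamma_sub A : is_subalgebra A -> Gamma_sub abs A one_series.
Proof.
move=> A_alg; have one1 : hmul abs one_series one_series = one_series.
  by rewrite -{1}power_series1 hmul_one_power_series power_series1.
have oneG := one_Gamma_at (lexx 0) ltr01.
have oneA : closure_H abs A one_series.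
  have oneH : Hfield abs one_series by case: oneG => -[].
  split=> // e e0; exists one_series; split=> //; first exact: subalg_1.
  apply: le_lt_trans e0; apply: hnorm_le => i.
  by rewrite /= subrr (absv0 absP).
exists one_series, one_series; split => //; first by split=> //; exists one_series.
by exists 0; split.
Qed.

End GammaSubgroup.

Lemma h_mu_class_injective (R : realType) (p : nat) (K : fieldType)
    (abs : K -> R) (A : set (int -> K)) (g : nat) (mu : 'I_g -> nat) :
  prime p -> absolute_value abs -> abs_complete abs ->
  (forall n, (0 < n)%N -> abs n%:R = (p ^ logn p n)%:R^-1) ->
  is_subalgebra A ->
  A `&` laurent_nonpos = [set c \*o one_series | c in [set: K]] ->
  strictly_integral abs A -> is_gap_sequence A mu ->
  set_fun (maximal_ideal_pow abs g) (Gamma_quot abs A)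
    (fun pi => Gamma_class abs A (h_mu abs p mu pi)) /\
  set_inj (maximal_ideal_pow abs g)
    (fun pi => Gamma_class abs A (h_mu abs p mu pi)).
Proof.
move=> p_prime absP K_complete abs_nat A_alg A_const A_int muP.
have abs_ge0 := absv_ge0 absP.
have [mu_mono mu_range] := muP.
have mu_gap i : ~ degrees A (mu i).
  by have : (~` degrees A) (mu i) by rewrite -mu_range; exists i.
have mu_gt0 i : (0 < mu i)%N.
  by rewrite lt0n; apply/eqP => mu0; apply: (mu_gap i); rewrite mu0; exact: degrees0.
have mu_inj : injective mu.
  move=> i j ij; apply/val_inj; have [/mu_mono|/mu_mono|//] := ltngtP i j;
  by rewrite ij ltnn.
split.
  move=> pi pi1; exists (h_mu abs p mu pi) => //.
  have [i|rho [rho0 rho1 pi_rho]] := exists_radius mu_gt0 (F := abs \o pi).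
    by rewrite abs_ge0 pi1.
  exists rho; split=> //; rewrite (h_mu_power_series p absP).
  apply: power_series_Gamma_at => //.
  have [] // := h_mu_perturbed absP p_prime abs_nat mu_gt0 rho0 rho1
    (lexx 0) pi_rho pi_rho.
  by move=> i; rewrite subrr (absv0 absP).
move=> pi pi'; rewrite !inE => pi1 pi'1 classE.
apply/funext => i; apply/eqP/negPn/negP => pi_i.
have [j _ j_max] := @arg_maxP _ _ _ i xpredT (fun i => abs (pi i - pi' i)) isT.
set d := abs (pi j - pi' j) in j_max.
have d_max k : abs (pi k - pi' k) <= d by exact: j_max.
have d0 : 0 < d.
  by apply: lt_le_trans (d_max i); apply: (absv_gt0 absP); rewrite subr_eq0.
have d1 : d < 1 by apply: (absv_ltB absP).
have [k|rho [rho0 rho1 pi_rho]] :=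
    exists_radius mu_gt0 (F := fun i => Num.max (abs (pi i)) (abs (pi' i))).
  by rewrite le_max abs_ge0 /= gt_max pi1 pi'1.
have [k|k|geo geo' Dd hD] := h_mu_perturbed absP p_prime abs_nat mu_gt0 rho0 rho1
  (ltW d0) _ _ d_max.
- by apply: le_trans (pi_rho k); rewrite le_max lexx.
- by apply: le_trans (pi_rho k); rewrite le_max lexx orbT.
set D := \sum_(i < g) _ in Dd hD.
have DE m : D m = \sum_(i < g) (if m == mu i then pi i - pi' i else 0).
  by rewrite /D fct_sumE.
have D_mu k : D (mu k) = pi k - pi' k.
  rewrite DE (bigD1 k) //= eqxx big1 ?addr0 // => l lk.
  by rewrite (inj_eq mu_inj) eq_sym (negPf lk).
have D_deg m : degrees A m -> D m = 0.
  move=> mA; rewrite DE big1 // => l _; case: eqP => // ml.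
  by case: (mu_gap l); rewrite -ml.
have : Gamma_class abs A (h_mu abs p mu pi) (h_mu abs p mu pi).
  exists one_series; first exact: one_Gamma_sub.
  by rewrite (h_mu_power_series p absP) hmul_one_power_series.
rewrite classE => -[_ [u [c [[uA _] [r [r0 r1 uG]] cG ->]]] /esym hE].
rewrite !(h_mu_power_series p absP) in hE.
have [||||||t td /(_ (mu j) (mu_gt0 j))] :=
    gap_coef_lt absP K_complete A_const A_int (D := power_series D) hE
      (power_series_Hfield absP rho0 rho1 geo') _ _ _ rho0 rho1 uA r0 r1 uG cG d0 d1.
- by case.
- by case: geo'.
- case=> [[|k]|k] // _; case: geo' => _ h'.
    by rewrite (le_trans (h' _)) // -{2}[rho]expr1 ler_wiXn2l // ltW.
  by rewrite (absv0 absP).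
- by case=> [n|n]; rewrite /= ?Dd // (absv0 absP) ltW.
- case=> [n|n]; rewrite /= ?hD // !subrr (absv0 absP) mulr_ge0 // ltW //.
- exact: D_deg.
by rewrite /= D_mu -/d leNgt td.
Qed.

Theorem proposition3p7 (R : realType) (p : nat) (p_prime : prime p)
    (Qp : fieldType) (absQ : Qp -> R) (QpP : is_padic_field p absQ)
    (K : fieldExtType Qp) (abs : K -> R) (absP : extends_abs absQ abs)
    (A : set (int -> K)) (A_alg : is_subalgebra A)
    (A_const : A `&` laurent_nonpos = [set c \*o one_series | c in [set: K]])
    (g : nat) (A_dim : quotient_dim laurent (set_sum A laurent_nonpos) g)
    (A_int : strictly_integral abs A)
    (mu : 'I_g -> nat) (muP : is_gap_sequence A mu) :
  set_fun (maximal_ideal_pow abs g) (Gamma_quot abs A)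
    (fun pi => Gamma_class abs A (h_mu abs p mu pi)) /\
  set_inj (maximal_ideal_pow abs g)
    (fun pi => Gamma_class abs A (h_mu abs p mu pi)).
Proof.
have abs_nat := padic_ext_abs_nat QpP absP; have [absvP abs_ext] := absP.
have K_complete := fieldExt_complete (padic_absv QpP) absvP abs_ext (padic_complete QpP).
exact: h_mu_class_injective.
Qed.
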